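(* Let $R$ be a commutative ring with non-zero identity, let $M$ be a non-zero faithful multiplication $R$-module, and let $I$ be a 1-absorbing prime ideal of $R$. Then for all non-unit elements $a,b\in R$ and all $m\in M$, $abm\in IM$ implies $ab\in I$ or $m\in IM$.
   Context: All modules are unital. $M$ is faithful if $\mathrm{Ann}(M)=\{r\in R: rM=0\}=0$. $M$ is a multiplication module if every submodule of $M$ has the form $JM$ for some ideal $J$ of $R$. A proper ideal $I$ of $R$ is a 1-absorbing prime ideal if for all non-unit elements $a,b,c\in R$, $abc\in I$ implies $ab\in I$ or $c\in I$. *)

(* Defs.v *)
From HB Require Import structures.
From mathcomp Require Import all_boot all_order all_algebra.
From mathcomp Require Import boolp classical_sets.

Set Implicit Arguments.
Unset Strict Implicit.
Unset Printing Implicit Defensive.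

Import GRing.Theory.

Local Open Scope classical_set_scope.
Local Open Scope ring_scope.

(* [GRing.unit] would require a [comUnitRingType], i.e. a ring bundled with a
   boolean invertibility test; rings here are arbitrary. *)
Definition is_unit (R : comNzRingType) (a : R) : Prop := exists b, a * b = 1.

(* [set M] rather than [{pred M}], so that membership need not be decidable. *)
Definition submodule (R : pzRingType) (M : lmodType R) (N : set M) : Prop :=
  GRing.submod_closed [in N].

Definition ideal (R : comNzRingType) (J : set R) : Prop :=
  submodule (J : set R^o).

(* The submodule J M, consisting of the finite sums of products a m with a in J
   and m in M; the empty sum n = 0 is allowed. *)
Definition ideal_smul (R : comNzRingType) (M : lmodType R) (J : set R) :
    set M :=
  [set v | exists (n : nat) (a : 'I_n -> R) (x : 'I_n -> M),
    (forall i, J (a i)) /\ v = \sum_(i < n) a i *: x i].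
Arguments ideal_smul {R} M J.

Definition annihilator (R : comNzRingType) (M : lmodType R) : set R :=
  [set r | forall m : M, r *: m = 0].

Definition faithful_module (R : comNzRingType) (M : lmodType R) : Prop :=
  annihilator M = [set 0].

Definition multiplication_module (R : comNzRingType) (M : lmodType R) : Prop :=
  forall N : set M, submodule N ->
    exists J : set R, ideal J /\ N = ideal_smul M J.

Definition one_absorbing_prime (R : comNzRingType) (I : set R) : Prop :=
  [/\ ideal I, I <> [set: R] &
    forall a b c : R, ~ is_unit a -> ~ is_unit b -> ~ is_unit c ->
      I (a * b * c) -> I (a * b) \/ I c].

(* Main.v *)
(* For [m] in [M], writing the cyclic submodules [R m], [R y] as [J M] gives
   [m = t m], where [t] is a sum of elements [u] with [u M] contained in a
   cyclic submodule [R g].  If [u M] lies in [R g], then faithfulness makes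
   [u Ann(g) = 0], so from [u m = s g] and [a b m] in [I M] one gets
   [a b (s u)] in [I].  Hence [a b] is in [I], or [s u] is, and then
   [u^2 m = (s u) g] is in [I M].  In the second case [t] belongs to the radical
   of the ideal [(I M : m)], and [m = t^n m] is in [I M]. *)
Require Import Defs.
From HB Require Import structures.
From mathcomp Require Import all_boot all_order all_algebra.
From mathcomp Require Import boolp classical_sets.

Set Implicit Arguments.
Unset Strict Implicit.
Unset Printing Implicit Defensive.

Import GRing.Theory.

Local Open Scope classical_set_scope.
Local Open Scope ring_scope.

Lemma submoduleP (R : pzRingType) (M : lmodType R) (N : set M) :
  submodule N <-> N 0 /\ forall a u v, N u -> N v -> N (a *: u + v).
Proof.
split=> -[N0 Nlin]; split.
- exact: set_mem.
- by move=> a u v /mem_set Nu /mem_set Nv; apply: set_mem; apply: Nlin.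
- by rewrite inE.
- by move=> a u v; rewrite !inE; apply: Nlin.
Qed.

Section Submodule.
Variables (R : pzRingType) (M : lmodType R) (N : set M).
Hypothesis subN : submodule N.

Lemma submodule0 : N 0.
Proof. by case/submoduleP: subN. Qed.

Lemma submoduleD u v : N u -> N v -> N (u + v).
Proof.
by case/submoduleP: subN => _ Nlin Nu Nv; rewrite -[u]scale1r; apply: Nlin.
Qed.

Lemma submoduleZ a u : N u -> N (a *: u).
Proof.
case/submoduleP: subN => N0 Nlin Nu.
by rewrite -[_ *: _]addr0; apply: Nlin.
Qed.

Lemma submodule_sum (n : nat) (F : 'I_n -> M) :
  (forall i, N (F i)) -> N (\sum_(i < n) F i).
Proof.
by move=> NF; apply: big_ind => //; [apply: submodule0|apply: submoduleD].
Qed.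

End Submodule.

Lemma ideal_mull (R : comNzRingType) (I : set R) (a r : R) :
  ideal I -> I a -> I (r * a).
Proof. by move=> idI Ia; apply: (submoduleZ (M := R^o) idI). Qed.

Section IdealSmul.
Variables (R : comNzRingType) (M : lmodType R).
Implicit Types (I J : set R) (N : set M).

Lemma mem_ideal_smul J a (v : M) : J a -> ideal_smul M J (a *: v).
Proof.
by move=> Ja; exists 1, (fun=> a), (fun=> v); rewrite big_ord1.
Qed.

Lemma ideal_smul_sub J N :
  submodule N -> (forall a v, J a -> N (a *: v)) -> ideal_smul M J `<=` N.
Proof.
move=> subN JN v [n [a [x [Ja ->]]]].
by apply: submodule_sum => // i; apply: JN.
Qed.

Lemma ideal_smul_submodule J : ideal J -> submodule (ideal_smul M J).
Proof.
move=> idJ; apply/submoduleP; split.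
  exists 0, (fun=> 0), (fun=> 0); split; last by rewrite big_ord0.
  by case.
move=> r _ _ [n [a [x [Ja ->]]]] [p [b [y [Jb ->]]]].
exists (n + p)%N, (fun i => match split i with inl j => r * a j | inr k => b k end),
  (fun i => match split i with inl j => x j | inr k => y k end); split.
  by move=> i; case: (split i) => j //; apply: ideal_mull.
rewrite big_split_ord scaler_sumr; congr (_ + _); apply: eq_bigr => i _.
  by rewrite (unsplitK (inl _ i)) scalerA.
by rewrite (unsplitK (inr _ i)).
Qed.

(* With [J = setT] this is the cyclic submodule [R v]. *)
Lemma scale_submodule J (v : M) :
  ideal J -> submodule [set w | exists2 r, J r & w = r *: v].
Proof.
move=> idJ; apply/submoduleP; split.
  by exists 0; [apply: (submodule0 idJ)|rewrite scale0r].
move=> r _ _ [s Js ->] [t Jt ->]; exists (r * s + t).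
  by apply: (submoduleD idJ) => //; apply: ideal_mull.
by rewrite scalerDl scalerA.
Qed.

Lemma colon_ideal N (v : M) : submodule N -> ideal [set r | N (r *: v)].
Proof.
move=> subN; apply/submoduleP; split=> /=.
  by rewrite scale0r; apply: submodule0.
move=> r s t Ns Nt; rewrite scalerDl -scalerA.
by apply: submoduleD => //; apply: submoduleZ.
Qed.

(** With this, [ideal_smul_sub] also reduces a claim about [a *: v], for [v] in [J M], to the
    generators of [J M]. *)
Lemma submodule_preimZ (a : R) N : submodule N -> submodule [set v | N (a *: v)].
Proof.
move=> subN; apply/submoduleP; split=> /=.
  by rewrite scaler0; apply: submodule0.
move=> r u v Nu Nv; rewrite scalerDr scalerA mulrC -scalerA.
by apply: submoduleD => //; apply: submoduleZ.
Qed.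

End IdealSmul.

Lemma setT_ideal (R : comNzRingType) : ideal [set: R].
Proof. by apply/submoduleP. Qed.

Definition radical (R : comNzRingType) (K : set R) : set R :=
  [set r | exists n, K (r ^+ n)].

Lemma radical_ideal (R : comNzRingType) (K : set R) : ideal K -> ideal (radical K).
Proof.
move=> idK; apply/submoduleP; split.
  by exists 1; rewrite expr1; apply: (submodule0 idK).
move=> a r s [n Kr] [p Ks]; exists (n + p)%N; rewrite exprDn.
apply: (submodule_sum idK) => i; rewrite -mulr_natl; apply: ideal_mull => //.
(* In the binomial term of index [i], either [s] has exponent at least [p], or [a * r] has exponent
   [n + p - i], at least [n]. *)
case: (leqP p i) => [le_pi | lt_ip].
  by apply: ideal_mull => //; rewrite -(subnK le_pi) exprD; apply: ideal_mull.
have le_n : (n <= n + p - i)%N by rewrite -addnBA ?leq_addr // ltnW.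
rewrite mulrC; apply: ideal_mull => //; rewrite -(subnK le_n) exprD.
apply: ideal_mull => //; rewrite -[a *: r]/(a * r) exprMn.
exact: ideal_mull.
Qed.

(** The union over [g] of the colon ideals [(R g : M)]. It is stable under multiples but in general
    not under sums, so it is used through ideals [L] containing it. *)
Definition cyclic_multiplier (R : comNzRingType) (M : lmodType R) : set R :=
  [set t | exists g : M, forall v : M, exists r, t *: v = r *: g].
Arguments cyclic_multiplier {R} M.

Lemma cyclic_multiplier_mull (R : comNzRingType) (M : lmodType R) (r t : R) :
  cyclic_multiplier M t -> cyclic_multiplier M (r * t).
Proof.
move=> [g tg]; exists g => v; have [s ts] := tg v.
by exists (r * s); rewrite -!scalerA ts.
Qed.

Lemma cyclic_submodule_smul (R : comNzRingType) (M : lmodType R) (x : M) :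
  multiplication_module M ->
  exists J : set R, ideal_smul M J x /\
    forall a v, J a -> exists r, a *: v = r *: x.
Proof.
move=> multM.
have [J [_ eqJ]] := multM _ (scale_submodule x (@setT_ideal R)).
exists J; split=> [|a v Ja].
  by rewrite -eqJ; exists 1; rewrite ?scale1r.
have: ideal_smul M J (a *: v) by apply: mem_ideal_smul.
by rewrite -eqJ => -[r _ ->]; exists r.
Qed.

(** Write [R x = J M], and [R y = J' M] for each [y]. Then [x] is a sum of terms [a b z] with [a] in
    [J] and [b] in some [J']. Since [a z = c x], each term is [(c b) x], where [b M] lies in
    [R y]. *)
Lemma multiplication_module_fix (R : comNzRingType) (M : lmodType R)
    (L : set R) (x : M) :
  multiplication_module M -> ideal L -> cyclic_multiplier M `<=` L ->
  exists2 t, L t & x = t *: x.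
Proof.
move=> multM idL cycL.
have subLx := scale_submodule x idL.
have [J [Jx cycJ]] := cyclic_submodule_smul x multM.
(* The goal says that [x] lies in the submodule [L x], so generators of [J M] suffice. *)
apply: (ideal_smul_sub subLx _ Jx) => a y Ja.
have [J' [J'y cycJ']] := cyclic_submodule_smul y multM.
apply: (ideal_smul_sub (submodule_preimZ a subLx)) J'y => b z J'b /=; have [c az] := cycJ _ z Ja.
exists (c * b); last by rewrite scalerA mulrC -scalerA az scalerA mulrC.
by apply/cycL/cyclic_multiplier_mull; exists y => v; apply: cycJ'.
Qed.

Lemma one_absorbing_cyclic_multiplier (R : comNzRingType) (M : lmodType R)
    (I : set R) (a b t : R) (m : M) :
  faithful_module M -> one_absorbing_prime I ->
  ~ is_unit a -> ~ is_unit b -> cyclic_multiplier M t ->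
  ideal_smul M I ((a * b) *: m) -> I (a * b) \/ ideal_smul M I (t ^+ 2 *: m).
Proof.
move=> faithM [idI _ absI] nua nub [g tg] Iabm.
have [s tm] := tg m.
(* As [t M] lies in [R g], [t I M] lies in [I g]. *)
have [p Ip tabm] : exists2 p, I p & t *: ((a * b) *: m) = p *: g.
  have subIg := scale_submodule g idI.
  apply: (ideal_smul_sub (submodule_preimZ t subIg)) Iabm => q v Iq /=; have [r tv] := tg v; exists (r * q); first exact: ideal_mull.
  by rewrite scalerA mulrC -scalerA tv scalerA mulrC.
(* Both [a b s g] and [p g] equal [t a b m], so [a b s - p] kills [g], hence also [t M]. *)
have annI : annihilator M ((a * b * s - p) * t).
  move=> v; have [r tv] := tg v.
  rewrite -scalerA tv scalerA mulrC -scalerA scalerBl -tabm -(scalerA _ s) -tm.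
  by rewrite !scalerA [t * _]mulrC subrr scaler0.
rewrite faithM /= in annI.
have Iabst : I (a * b * (s * t)).
  have -> : a * b * (s * t) = t * p.
    by apply/eqP; rewrite -subr_eq0 [t * p]mulrC mulrA -mulrBl annI.
  exact: ideal_mull.
(* The 1-absorbing property needs a non-unit third factor; if [s t] is a unit, it cancels and [a b]
   is in [I]. *)
case: (EM (is_unit (s * t))) => [[c stc]|nust].
  left; rewrite -[a * b]mulr1 -stc mulrA mulrC; exact: ideal_mull.
case: (absI _ _ _ nua nub nust Iabst) => [|Ist]; [by left|right].
by rewrite expr2 -scalerA tm scalerA mulrC; apply: mem_ideal_smul.
Qed.

Theorem theorem5 (R : comNzRingType) (M : lmodType R) (I : set R)
    (M_nonzero : exists m : M, m <> 0)
    (M_faithful : faithful_module M)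
    (M_mult : multiplication_module M)
    (I_prime : one_absorbing_prime I) :
  forall (a b : R) (m : M), ~ is_unit a -> ~ is_unit b ->
    ideal_smul M I ((a * b) *: m) -> I (a * b) \/ ideal_smul M I m.
Proof.
move=> a b m nua nub Iabm.
case: (EM (I (a * b))) => [|nIab]; [by left|right].
have [idI _ _] := I_prime.
have idL := radical_ideal (colon_ideal m (ideal_smul_submodule M idI)).
have [t|t [n Itm] mt] := multiplication_module_fix m M_mult idL.
  (* The exponent 2 comes from [t ^+ 2 *: m] in [one_absorbing_cyclic_multiplier]. *)
  move=> cyct; exists 2.
  by case: (one_absorbing_cyclic_multiplier M_faithful I_prime nua nub cyct Iabm).
(* Iterating [m = t m] turns membership of [t] in the radical into membership of [m] in [I M]. *)
suff -> : m = t ^+ n *: m by [].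
by elim: n {Itm} => [|n IHn]; rewrite ?scale1r // exprSr -scalerA -mt.
Qed.
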